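(* Let $k$ be a commutative associative unital ring, let $R\in k\text{-alg}$, let $\alpha\colon R\to S$ be a morphism in $k\text{-alg}$ making $S$ a faithfully flat $R$-algebra, and let $A$ and $B$ be $R$-algebras such that $B$ is an $S/R$-form of $A$ determined by the cocycle $u=\theta_2^{-1}\circ\theta_1\in \mathrm{Aut}_{S''}(A\otimes_R S'')$ associated to some $S$-algebra isomorphism $\theta\colon A\otimes_R S\to B\otimes_R S$. Let $F\colon k\text{-ALG}\to k\text{-MOD}$ be a functor over $k\text{-alg}$ which is stable under base change. Then $F_R(B)$ is an $S/R$-form of the $R$-module $F_R(A)$ (i.e. $F_R(A)\otimes_R S\cong F_R(B)\otimes_R S$ as $S$-modules), and $F_R(B)$ is isomorphic as an $R$-module to the $R$-module $L_z$ determined by the cocycle \[ z=\nu_{A,\alpha_2\circ\alpha}^{-1}\circ F(u)\circ \nu_{A,\alpha_1\circ\alpha}\in \mathrm{Aut}_{S''}\big(F_R(A)\otimes_R S''\big). \]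
   Context: $k$ is a commutative associative unital ring; $k\text{-alg}$ is the category of commutative associative unital $k$-algebras with unital algebra homomorphisms. For a commutative ring $R$, an $R$-algebra is an $R$-module $A$ with an $R$-bilinear product $A\times A\to A$ (no identities such as associativity or unit are assumed). For a morphism $\alpha\colon R\to S$ in $k\text{-alg}$, an $R$-module (resp. $R$-algebra) $M$ and an $S$-module (resp. algebra) $N$, a map $f\colon M\to N$ is $\alpha$-semilinear if it is additive with $f(rm)=\alpha(r)f(m)$ (and multiplicative in the algebra case). The category $k\text{-ALG}$ has objects pairs $(R,A)$ with $R\in k\text{-alg}$ and $A$ an $R$-algebra, and morphisms $(\alpha,f)\colon(R,A)\to(S,B)$ with $\alpha\colon R\to S$ in $k\text{-alg}$ and $f\colon A\to B$ an $\alpha$-semilinear algebra homomorphism; $k\text{-MOD}$ is defined in the same way with modules and module homomorphisms. For $\alpha\colon R\to S$ and an $R$-algebra $A$, write $A\otimes_\alpha S$ (or $A\otimes_R S$) for the base-changed $S$-algebra and $\alpha^A\colon A\to A\otimes_\alpha S$, $a\mapsto a\otimes 1$. A functor $F\colon k\text{-ALG}\to k\text{-MOD}$ is over $k\text{-alg}$ if $F(R,A)=(R,F_R(A))$ for an $R$-module $F_R(A)$ and $F(\alpha,f)=(\alpha,F_\alpha(f))$ for an $\alpha$-semilinear map $F_\alpha(f)$; when $\alpha$ is an identity we write $F(f)$ for $F_\alpha(f)$. For such $F$, $\alpha\colon R\to T$ and an $R$-algebra $A$ define the $T$-linear map $\nu_{A,\alpha}\colon F_R(A)\otimes_\alpha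 T\to F_T(A\otimes_\alpha T)$, $m\otimes t\mapsto t\,F_\alpha(\alpha^A)(m)$. $F$ is stable under base change if every $\nu_{A,\alpha}$ is an isomorphism. Descent notation: $S''=S\otimes_R S$, $\alpha_1,\alpha_2\colon S\to S''$, $\alpha_1(s)=s\otimes 1$, $\alpha_2(s)=1\otimes s$; $S''$ is an $R$-algebra via $\alpha_1\circ\alpha=\alpha_2\circ\alpha$. Given an $S$-algebra isomorphism $\theta\colon A\otimes_R S\to B\otimes_R S$, for $i=1,2$ let $\theta_i\colon A\otimes_R S''\to B\otimes_R S''$ be the $S''$-algebra isomorphism corresponding to $\theta\otimes_{\alpha_i}\mathrm{Id}_{S''}$ under the identifications $(X\otimes_R S)\otimes_{\alpha_i}S''\cong X\otimes_R S''$, $(x\otimes s)\otimes y\mapsto x\otimes \alpha_i(s)y$ ($X=A,B$). For an $R$-module $M$ and $z\in\mathrm{Aut}_{S''}(M\otimes_R S'')$, the $R$-module determined by $z$ is $L_z=\{x\in M\otimes_R S: z((\mathrm{Id}_M\otimes\alpha_1)(x))=(\mathrm{Id}_M\otimes\alpha_2)(x)\}$, where $\mathrm{Id}_M\otimes\alpha_i\colon M\otimes_R S\to M\otimes_R S''$, $m\otimes s\mapsto m\otimes\alpha_i(s)$. Here $F(u)=F_{\mathrm{Id}_{S''}}(u)$. *)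

(* Defs.v *)
(* Tensor products / base change are not in the library, so
   every base change is given by its universal property. *)
From mathcomp Require Import all_boot all_algebra.
Set Implicit Arguments. Unset Strict Implicit. Unset Printing Implicit Defensive.
Import GRing.Theory.
Local Open Scope ring_scope.

Definition rhom (R S : comPzRingType) (f : R -> S) : Prop :=
  [/\ forall x y, f (x + y) = f x + f y,
      forall x y, f (x * y) = f x * f y & f 1 = 1].

Record kalg (k : comPzRingType) := KAlg {
  kcar :> comPzRingType;
  kstr : k -> kcar;
  kstr_rhom : rhom kstr }.

Record kmor (k : comPzRingType) (R S : kalg k) := KMor {
  kfun :> R -> S;
  kfun_rhom : rhom kfun;
  kfun_k : forall c, kfun (kstr R c) = kstr S c }.

Lemma kid_rhom (k : comPzRingType) (R : kalg k) : rhom (fun x : R => x).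
Proof. by split. Qed.
Definition kid (k : comPzRingType) (R : kalg k) : kmor R R :=
  @KMor k R R (fun x => x) (kid_rhom R) (fun c => erefl).

Lemma kcomp_rhom (k : comPzRingType) (R S T : kalg k) (a : kmor R S) (b : kmor S T) :
  rhom (fun x => b (a x)).
Proof.
case: (kfun_rhom a) => a1 a2 a3; case: (kfun_rhom b) => b1 b2 b3.
by split => [x y|x y|]; rewrite ?a1 ?b1 ?a2 ?b2 ?a3 ?b3.
Qed.
Lemma kcomp_k (k : comPzRingType) (R S T : kalg k) (a : kmor R S) (b : kmor S T) c :
  b (a (kstr R c)) = kstr T c.
Proof. by rewrite !kfun_k. Qed.
Definition kcomp (k : comPzRingType) (R S T : kalg k) (a : kmor R S) (b : kmor S T)
  : kmor R T := @KMor k R T (fun x => b (a x)) (kcomp_rhom a b) (kcomp_k a b).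

Definition slinear (R S : comPzRingType) (a : R -> S) (M : lmodType R) (N : lmodType S)
  (f : M -> N) : Prop :=
  (forall x y, f (x + y) = f x + f y) /\ (forall r x, f (r *: x) = a r *: f x).

(* R-algebras: R-modules with an R-bilinear product (no further identities) *)
Record ralg (R : comPzRingType) := RAlg {
  ralg_mod :> lmodType R;
  amul : ralg_mod -> ralg_mod -> ralg_mod;
  amulDl : forall (r : R) x y z, amul (r *: x + y) z = r *: amul x z + amul y z;
  amulDr : forall (r : R) x y z, amul z (r *: x + y) = r *: amul z x + amul z y }.

(* alpha-semilinear algebra homomorphisms: the morphisms (alpha, f) of k-ALG *)
Record ahom (k : comPzRingType) (R S : kalg k) (a : kmor R S) (A : ralg R) (B : ralg S) :=
  AHom {
  afun :> A -> B;
  afun_slin : slinear a afun;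
  afun_mul : forall x y, afun (amul x y) = amul (afun x) (afun y) }.

(* A functor F : k-ALG -> k-MOD over k-alg:  F(R,A) = (R, FO R A),
   F(alpha,f) = (alpha, FM f) with FM f alpha-semilinear, functorial. *)
Record kfunctor (k : comPzRingType) := KFunctor {
  FO : forall R : kalg k, ralg R -> lmodType R;
  FM : forall (R S : kalg k) (a : kmor R S) (A : ralg R) (B : ralg S),
         ahom a A B -> FO A -> FO B;
  FM_slin : forall R S (a : kmor R S) A B (f : ahom a A B), slinear a (FM f);
  FM_id : forall (R : kalg k) (a : kmor R R) (A : ralg R) (f : ahom a A A),
      (forall r, a r = r) -> (forall x, f x = x) -> forall m, FM f m = m;
  FM_comp : forall (R S T : kalg k) (a : kmor R S) (b : kmor S T) (c : kmor R T)
      (A : ralg R) (B : ralg S) (C : ralg T)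
      (f : ahom a A B) (g : ahom b B C) (h : ahom c A C),
      (forall r, c r = b (a r)) -> (forall x, h x = g (f x)) ->
      forall m, FM h m = FM g (FM f m) }.
Arguments FM [k] F [R S a A B] _ _ : rename.

(* (X, j) is the base change M (x)_a T of the R-module M along a : R -> T,
   with j m = m (x) 1; characterized by its universal property. *)
Definition mod_bc (k : comPzRingType) (R T : kalg k) (a : kmor R T)
  (M : lmodType R) (X : lmodType T) (j : M -> X) : Prop :=
  slinear a j /\
  forall (Y : lmodType T) (g : M -> Y), slinear a g ->
    exists h : X -> Y, [/\ slinear (kid T) h, (forall m, h (j m) = g m) &
      forall h' : X -> Y, slinear (kid T) h' -> (forall m, h' (j m) = g m) ->
        forall x, h' x = h x].

(* (X, i) is the base-changed algebra A (x)_a T with i = a^A *)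
Definition alg_bc (k : comPzRingType) (R T : kalg k) (a : kmor R T)
  (A : ralg R) (X : ralg T) (i : ahom a A X) : Prop := mod_bc a (afun i).

Definition flat (k : comPzRingType) (R S : kalg k) (a : kmor R S) : Prop :=
  forall (M N : lmodType R) (f : M -> N), slinear (kid R) f -> injective f ->
  forall (MS NS : lmodType S) (jM : M -> MS) (jN : N -> NS),
    mod_bc a jM -> mod_bc a jN ->
  forall g : MS -> NS, slinear (kid S) g -> (forall m, g (jM m) = jN (f m)) ->
    injective g.

Definition faithfully_flat (k : comPzRingType) (R S : kalg k) (a : kmor R S) : Prop :=
  flat a /\
  forall (M : lmodType R) (MS : lmodType S) (jM : M -> MS), mod_bc a jM ->
    (forall x : MS, x = 0) -> forall m : M, m = 0.

(* S2 = S (x)_R S with a1 s = s (x) 1, a2 s = 1 (x) s: pushout in k-alg *)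
Definition ring_tensor (k : comPzRingType) (R S S2 : kalg k) (a : kmor R S)
  (a1 a2 : kmor S S2) : Prop :=
  (forall r, a1 (a r) = a2 (a r)) /\
  forall (C : kalg k) (f1 f2 : kmor S C), (forall r, f1 (a r) = f2 (a r)) ->
    exists h : kmor S2 C, [/\ (forall s, h (a1 s) = f1 s), (forall s, h (a2 s) = f2 s) &
      forall h' : kmor S2 C, (forall s, h' (a1 s) = f1 s) -> (forall s, h' (a2 s) = f2 s) ->
        forall x, h' x = h x].

(* F is stable under base change: every nu_{A,b} is bijective, where
   nu_{A,b} : F_R(A) (x)_b T -> F_T(A (x)_b T) is the T-linear map with
   nu (m (x) 1) = F_b(b^A)(m). *)
Definition stable_bc (k : comPzRingType) (F : kfunctor k) : Prop :=
  forall (R T : kalg k) (b : kmor R T) (A : ralg R) (AT : ralg T) (i : ahom b A AT),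
    alg_bc i ->
  forall (X : lmodType T) (j : FO F A -> X), mod_bc b j ->
  forall nu : X -> FO F AT, slinear (kid T) nu -> (forall m, nu (j m) = FM F i m) ->
    bijective nu.

(* Main.v *)
(* Stability of F under base change gives an S-isomorphism
   Phi = nu_B^-1 o F(theta) o nu_A : F_R(A) (x) S -> F_R(B) (x) S.  Naturality
   of nu transports the two descent maps F_R(B) (x) S -> F_R(B) (x) S'' through
   Phi into F(theta_2) o nu o z o (Id (x) alpha_1) and
   F(theta_2) o nu o (Id (x) alpha_2), because theta_1 = theta_2 o u.  Hence
   x lies in L_z exactly when Phi x is equalized by the descent maps of F_R(B),
   i.e., by faithfully flat descent, when Phi x lies in F_R(B) (x) 1.
   Descent for modules: along a faithfully flat S, injectivity and
   surjectivity of linear maps descend, so it suffices to show that the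
   equalizer E of the two maps MS -> MS'' is spanned by M after tensoring with
   S.  Letting s (x) s' act on MS (x)_R S by s on the left and s' on the right
   turns e1 x = e2 x, for x = sum s_i m_i, into x (x) 1 = sum m_i (x) s_i. *)

Require Import Defs.
From HB Require Import structures.
From mathcomp Require Import all_boot all_algebra.
From mathcomp Require Import boolp.
Set Implicit Arguments. Unset Strict Implicit. Unset Printing Implicit Defensive.
Import GRing.Theory.
Local Open Scope ring_scope.

Section Semilinear.
Variables (R S : comPzRingType) (phi : R -> S) (M : lmodType R) (N : lmodType S)
  (f : M -> N) (hf : slinear phi f).

Lemma slinearD x y : f (x + y) = f x + f y. Proof. exact: hf.1. Qed.
Lemma slinearZ r x : f (r *: x) = phi r *: f x. Proof. exact: hf.2. Qed.
Lemma slinear0 : f 0 = 0.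
Proof. by apply: (addIr (f 0)); rewrite -slinearD !add0r. Qed.
Lemma slinearN x : f (- x) = - f x.
Proof. by apply: (addIr (f x)); rewrite -slinearD !addNr slinear0. Qed.
Lemma slinearB x y : f (x - y) = f x - f y.
Proof. by rewrite slinearD slinearN. Qed.
End Semilinear.

Lemma slinear_comp (k : comPzRingType) (R S T : kalg k) (a : kmor R S) (b : kmor S T)
  (c : R -> T) (X : lmodType R) (Y : lmodType S) (Z : lmodType T) (f : X -> Y) (g : Y -> Z) :
  slinear a f -> slinear b g -> (forall r, c r = b (a r)) -> slinear c (fun x => g (f x)).
Proof.
move=> hf hg hc; split => [x y|r x]; first by rewrite (slinearD hf) (slinearD hg).
by rewrite (slinearZ hf) (slinearZ hg) hc.
Qed.

Lemma slinear_can (k : comPzRingType) (T : kalg k) (X Y : lmodType T) (f : X -> Y) (g : Y -> X) :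
  slinear (kid T) f -> cancel f g -> cancel g f -> slinear (kid T) g.
Proof.
move=> hf fK gK; split => [x y|r x]; first by rewrite -{1}[x]gK -{1}[y]gK -(slinearD hf) fK.
by rewrite -{1}[x]gK -[r *: f (g x)]/(kid T r *: f (g x)) -(slinearZ hf) fK.
Qed.

Definition lincomb (K : pzRingType) (I : Type) (Y : lmodType K) (g : I -> Y)
  (r : seq (I * K)) : Y := \sum_(p <- r) p.2 *: g p.1.

Section Lincomb.
Variables (K : pzRingType) (I : Type) (Y : lmodType K) (g : I -> Y).

Lemma lincomb_nil : lincomb g [::] = 0. Proof. by rewrite /lincomb big_nil. Qed.
Lemma lincomb_cons p r : lincomb g (p :: r) = p.2 *: g p.1 + lincomb g r.
Proof. by rewrite /lincomb big_cons. Qed.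
Lemma lincomb_cat r r' : lincomb g (r ++ r') = lincomb g r + lincomb g r'.
Proof. by rewrite /lincomb big_cat. Qed.
Lemma lincombN r : lincomb g [seq (p.1, - p.2) | p <- r] = - lincomb g r.
Proof. by rewrite /lincomb big_map -sumrN; apply: eq_bigr => p _; rewrite scaleNr. Qed.
Lemma lincombZ s r : lincomb g [seq (p.1, s * p.2) | p <- r] = s *: lincomb g r.
Proof. by rewrite /lincomb big_map scaler_sumr; apply: eq_bigr => p _; rewrite scalerA. Qed.
Lemma lincomb_eq0 r : (forall i, g i = 0) -> lincomb g r = 0.
Proof. by move=> g0; rewrite /lincomb big1 // => p _; rewrite g0 scaler0. Qed.
End Lincomb.

Lemma slinear_lincomb (S0 S1 : comPzRingType) (phi : S0 -> S1) (I : Type) (X : lmodType S0)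
  (Y : lmodType S1) (j : I -> X) (f : X -> Y) : slinear phi f -> forall r,
  f (lincomb j r) = lincomb (fun i => f (j i)) [seq (p.1, phi p.2) | p <- r].
Proof.
move=> hf; elim=> [|p r IH] /=; first by rewrite !lincomb_nil (slinear0 hf).
by rewrite !lincomb_cons (slinearD hf) (slinearZ hf) IH.
Qed.
Arguments slinear_lincomb [S0 S1 phi I X Y j f].

Lemma linear_lincomb (k : comPzRingType) (T : kalg k) (I : Type) (X Y : lmodType T)
  (j : I -> X) (f : X -> Y) : slinear (kid T) f -> forall r,
  f (lincomb j r) = lincomb (fun i => f (j i)) r.
Proof. by move=> hf r; rewrite (slinear_lincomb hf); congr lincomb; elim: r => //= -[x y] r ->. Qed.
Arguments linear_lincomb [k T I X Y j f].

(** * Quotient modules *)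

(* A module presented as a type with module operations satisfying the module
   axioms only up to a congruence [qrel]. *)
Record quot_data (K : pzRingType) := QuotData {
  qcar : Type;
  qrel : qcar -> qcar -> Prop;
  qzero : qcar; qadd : qcar -> qcar -> qcar; qopp : qcar -> qcar; qscale : K -> qcar -> qcar;
  qrel_refl : forall x, qrel x x;
  qrel_sym : forall x y, qrel x y -> qrel y x;
  qrel_trans : forall x y z, qrel x y -> qrel y z -> qrel x z;
  qadd_rel : forall x x' y y', qrel x x' -> qrel y y' -> qrel (qadd x y) (qadd x' y');
  qopp_rel : forall x x', qrel x x' -> qrel (qopp x) (qopp x');
  qscale_rel : forall a x x', qrel x x' -> qrel (qscale a x) (qscale a x');
  qaddA : forall x y z, qrel (qadd x (qadd y z)) (qadd (qadd x y) z);
  qaddC : forall x y, qrel (qadd x y) (qadd y x);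
  qadd0 : forall x, qrel (qadd qzero x) x;
  qaddN : forall x, qrel (qadd (qopp x) x) qzero;
  qscaleA : forall a b x, qrel (qscale a (qscale b x)) (qscale (a * b) x);
  qscale1 : forall x, qrel (qscale 1 x) x;
  qscaleDr : forall a x y, qrel (qscale a (qadd x y)) (qadd (qscale a x) (qscale a y));
  qscaleDl : forall a b x, qrel (qscale (a + b) x) (qadd (qscale a x) (qscale b x)) }.
Arguments qrel {K} q _ _. Arguments qzero {K} q. Arguments qadd {K} q _ _.
Arguments qopp {K} q _. Arguments qscale {K} q _ _.

Definition quot K (d : quot_data K) : Type := {P : qcar d -> Prop | exists x, P = qrel d x}.
HB.instance Definition _ K (d : quot_data K) := gen_eqMixin (quot d).
HB.instance Definition _ K (d : quot_data K) := gen_choiceMixin (quot d).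

Section QuotType.
Variables (K : pzRingType) (d : quot_data K).

Definition qclass (x : qcar d) : quot d := exist _ (qrel d x) (ex_intro _ x erefl).
Definition qrepr (q : quot d) : qcar d := projT1 (cid (projT2 q)).

Lemma qclass_eq x y : qrel d x y -> qclass x = qclass y.
Proof.
move=> xy; apply: eq_exist_uncurried => /=.
have e : qrel d x = qrel d y.
  apply: funext => z; apply: propext; split; first exact: qrel_trans (qrel_sym xy).
  exact: qrel_trans xy.
by exists e; apply: Prop_irrelevance.
Qed.

Lemma qclass_eqP x y : qclass x = qclass y -> qrel d x y.
Proof.
move=> h; have -> : qrel d x = qrel d y by exact: (congr1 (@proj1_sig _ _) h).
exact: qrel_refl.
Qed.

Lemma qreprK q : qclass (qrepr q) = q.
Proof.
rewrite /qrepr; case: (cid _) => x /= e; case: q e => P hP /= e.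
by apply: eq_exist_uncurried; exists (esym e); apply: Prop_irrelevance.
Qed.

Lemma qclass_surj q : exists x, q = qclass x.
Proof. by exists (qrepr q); rewrite qreprK. Qed.

Lemma qrepr_rel x : qrel d (qrepr (qclass x)) x.
Proof. by apply: qclass_eqP; rewrite qreprK. Qed.

Definition quot_add q q' := qclass (qadd d (qrepr q) (qrepr q')).
Definition quot_opp q := qclass (qopp d (qrepr q)).
Definition quot_scale a q := qclass (qscale d a (qrepr q)).

Lemma quot_addE x y : quot_add (qclass x) (qclass y) = qclass (qadd d x y).
Proof. by apply: qclass_eq; apply: qadd_rel; apply: qrepr_rel. Qed.
Lemma quot_oppE x : quot_opp (qclass x) = qclass (qopp d x).
Proof. by apply: qclass_eq; apply: qopp_rel; apply: qrepr_rel. Qed.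
Lemma quot_scaleE a x : quot_scale a (qclass x) = qclass (qscale d a x).
Proof. by apply: qclass_eq; apply: qscale_rel; apply: qrepr_rel. Qed.

Lemma quot_addA : associative quot_add.
Proof.
move=> a b c; case: (qclass_surj a) (qclass_surj b) (qclass_surj c) => x -> [y ->] [z ->].
by rewrite !quot_addE; apply: qclass_eq; apply: qaddA.
Qed.
Lemma quot_addC : commutative quot_add.
Proof.
move=> a b; case: (qclass_surj a) (qclass_surj b) => x -> [y ->].
by rewrite !quot_addE; apply: qclass_eq; apply: qaddC.
Qed.
Lemma quot_add0 : left_id (qclass (qzero d)) quot_add.
Proof. by move=> a; case: (qclass_surj a) => x ->; rewrite quot_addE; apply/qclass_eq/qadd0. Qed.
Lemma quot_addN : left_inverse (qclass (qzero d)) quot_opp quot_add.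
Proof.
by move=> a; case: (qclass_surj a) => x ->; rewrite quot_oppE quot_addE; apply/qclass_eq/qaddN.
Qed.
End QuotType.

HB.instance Definition _ K (d : quot_data K) :=
  GRing.isZmodule.Build (quot d) (@quot_addA K d) (@quot_addC K d) (@quot_add0 K d)
    (@quot_addN K d).

Section QuotLmod.
Variables (K : pzRingType) (d : quot_data K).

Lemma quot_addE' (u v : quot d) : u + v = quot_add u v. Proof. by []. Qed.

Lemma quot_scaleA a b (v : quot d) : quot_scale a (quot_scale b v) = quot_scale (a * b) v.
Proof. by case: (qclass_surj v) => x ->; rewrite !quot_scaleE; apply/qclass_eq/qscaleA. Qed.
Lemma quot_scale1 : left_id 1 (@quot_scale K d).
Proof. by move=> v; case: (qclass_surj v) => x ->; rewrite quot_scaleE; apply/qclass_eq/qscale1. Qed.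
Lemma quot_scaleDr : right_distributive (@quot_scale K d) +%R.
Proof.
move=> a u v; case: (qclass_surj u) (qclass_surj v) => x -> [y ->].
by rewrite !quot_addE' quot_addE !quot_scaleE quot_addE; apply/qclass_eq/qscaleDr.
Qed.
Lemma quot_scaleDl (v : quot d) : {morph (@quot_scale K d)^~ v : a b / a + b}.
Proof.
move=> a b; case: (qclass_surj v) => x ->.
by rewrite !quot_addE' !quot_scaleE quot_addE; apply/qclass_eq/qscaleDl.
Qed.
End QuotLmod.

HB.instance Definition _ K (d : quot_data K) :=
  GRing.Zmodule_isLmodule.Build K (quot d) (@quot_scaleA K d) (@quot_scale1 K d)
    (@quot_scaleDr K d) (@quot_scaleDl K d).

Section QuotTheory.
Variables (K : pzRingType) (d : quot_data K).

Lemma qclassD x y : qclass x + qclass y = qclass (qadd d x y) :> quot d.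
Proof. exact: quot_addE. Qed.
Lemma qclassZ a x : a *: qclass x = qclass (qscale d a x) :> quot d.
Proof. exact: quot_scaleE. Qed.
Lemma qclass0 : qclass (qzero d) = 0 :> quot d.
Proof. by []. Qed.
End QuotTheory.

(** * Base change of modules *)

Section Tensor.
Variables (k : comPzRingType) (R S : kalg k) (a : kmor R S) (M : lmodType R).

(* [M (x)_a S] as formal sums [sum s_i (m_i (x) 1)], two sums being identified
   when every [a]-semilinear map agrees on them. *)
Definition tensor_rel (r r' : seq (M * S)) : Prop :=
  forall (Y : lmodType S) (g : M -> Y), slinear a g -> lincomb g r = lincomb g r'.

Definition tensor_data : quot_data S.
refine (@QuotData S (seq (M * S)) tensor_rel [::] cat
  (map (fun p => (p.1, - p.2))) (fun s => map (fun p => (p.1, s * p.2)))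
  _ _ _ _ _ _ _ _ _ _ _ _ _ _).
- by [].
- by move=> x y h Y g hg; rewrite h.
- by move=> x y z h1 h2 Y g hg; rewrite h1 ?h2.
- by move=> x x' y y' h1 h2 Y g hg; rewrite !lincomb_cat h1 ?h2.
- by move=> x x' h Y g hg; rewrite !lincombN h.
- by move=> s x x' h Y g hg; rewrite !lincombZ h.
- by move=> x y z Y g hg; rewrite catA.
- by move=> x y Y g hg; rewrite !lincomb_cat addrC.
- by [].
- by move=> x Y g hg; rewrite lincomb_cat lincombN addNr lincomb_nil.
- by move=> s t x Y g hg; rewrite !lincombZ scalerA.
- by move=> x Y g hg; rewrite lincombZ scale1r.
- by move=> s x y Y g hg; rewrite lincombZ !lincomb_cat !lincombZ scalerDr.
- by move=> s t x Y g hg; rewrite lincombZ !lincomb_cat !lincombZ scalerDl.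
Defined.

Definition tensor : lmodType S := quot tensor_data.
Definition tensor_in (m : M) : tensor := @qclass _ tensor_data [:: (m, 1)].

Lemma qclass_lincomb (r : seq (M * S)) : @qclass _ tensor_data r = lincomb tensor_in r.
Proof.
elim: r => [|p r IH]; first by rewrite lincomb_nil.
rewrite lincomb_cons -IH /tensor_in qclassZ qclassD; apply: qclass_eq => Y g hg /=.
by case: p => m s /=; rewrite mulr1.
Qed.

Lemma tensor_in_slinear : slinear a tensor_in.
Proof.
split=> [x y|r x]; rewrite /tensor_in ?qclassD ?qclassZ; apply: qclass_eq => Y g hg /=;
  rewrite !lincomb_cons !lincomb_nil !addr0 !scale1r.
  exact: (slinearD hg).
by rewrite mulr1 (slinearZ hg).
Qed.

Lemma tensor_bc : mod_bc a tensor_in.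
Proof.
split=> [|Y g hg]; first exact: tensor_in_slinear.
have lift r r' : qclass r = qclass r' :> tensor -> lincomb g r = lincomb g r'.
  by move=> /qclass_eqP; apply.
exists (fun q : tensor => lincomb g (qrepr q)); split.
- split=> [x y|r x]; rewrite -?lincomb_cat -?lincombZ; apply: lift.
    by rewrite qreprK -qclassD !qreprK.
  by rewrite qreprK -qclassZ !qreprK.
- move=> m; rewrite -[g m](_ : lincomb g [:: (m, 1)] = g m); first by apply: lift; rewrite qreprK.
  by rewrite lincomb_cons lincomb_nil addr0 scale1r.
- move=> h hh hm x; rewrite -[x in LHS]qreprK qclass_lincomb (linear_lincomb hh).
  by rewrite /lincomb; apply: eq_bigr => p _; rewrite hm.
Qed.
End Tensor.

Section BaseChange.
Variables (k : comPzRingType) (R S : kalg k) (a : kmor R S) (M : lmodType R)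
  (X : lmodType S) (j : M -> X) (hj : mod_bc a j).

Lemma mod_bc_lift (Y : lmodType S) (g : M -> Y) : slinear a g ->
  {h : X -> Y | slinear (kid S) h /\ forall m, h (j m) = g m}.
Proof. by move=> hg; apply: cid; case: (hj.2 Y g hg) => h [h1 h2 _]; exists h. Qed.

Lemma mod_bc_span x : exists r : seq (M * S), x = lincomb j r.
Proof.
have [f [hf fE]] := mod_bc_lift (tensor_bc a M).1.
have [_ /(_ X j hj.1) [g [hg gE _]]] := tensor_bc a M.
have gfK y : g (f y) = y.
  have [i [_ _ iU]] := hj.2 X j hj.1.
  rewrite (iU (fun x => g (f x))); last by move=> m; rewrite fE gE.
    by rewrite -(iU id).
  exact: (slinear_comp hf hg).
exists (qrepr (f x)).
rewrite -{1}[x]gfK -{1}[f x]qreprK qclass_lincomb (linear_lincomb hg).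
by rewrite /lincomb; apply: eq_bigr => p _; rewrite gE.
Qed.

Lemma mod_bc_ext (T : comPzRingType) (phi : S -> T) (Y : lmodType T) (f f' : X -> Y) :
  slinear phi f -> slinear phi f' -> (forall m, f (j m) = f' (j m)) -> f =1 f'.
Proof.
move=> hf hf' e x; have [r ->] := mod_bc_span x.
by rewrite (slinear_lincomb hf) (slinear_lincomb hf'); apply: eq_bigr => p _; rewrite e.
Qed.
End BaseChange.

Definition restr (k : comPzRingType) (R S : kalg k) (a : kmor R S) (V : lmodType S) : Type := V.
HB.instance Definition _ (k : comPzRingType) (R S : kalg k) (a : kmor R S) (V : lmodType S) :=
  GRing.Zmodule.on (@restr k R S a V).

Section Restriction.
Variables (k : comPzRingType) (R S : kalg k) (a : kmor R S) (V : lmodType S).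

Definition restr_scale (r : R) (v : restr a V) : restr a V := a r *: (v : V).
Lemma restr_scaleA r s v : restr_scale r (restr_scale s v) = restr_scale (r * s) v.
Proof. by case: (kfun_rhom a) => _ aM _; rewrite /restr_scale scalerA aM. Qed.
Lemma restr_scale1 : left_id 1 restr_scale.
Proof. by case: (kfun_rhom a) => _ _ a1 v; rewrite /restr_scale a1 scale1r. Qed.
Lemma restr_scaleDr : right_distributive restr_scale +%R.
Proof. by move=> r u v; rewrite /restr_scale scalerDr. Qed.
Lemma restr_scaleDl v : {morph restr_scale^~ v : r s / r + s}.
Proof. by case: (kfun_rhom a) => aD _ _ r s; rewrite /restr_scale aD scalerDl. Qed.
End Restriction.

HB.instance Definition _ (k : comPzRingType) (R S : kalg k) (a : kmor R S) (V : lmodType S) :=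
  GRing.Zmodule_isLmodule.Build R (@restr k R S a V) (@restr_scaleA k R S a V)
    (@restr_scale1 k R S a V) (@restr_scaleDr k R S a V) (@restr_scaleDl k R S a V).

Lemma restrZ (k : comPzRingType) (R S : kalg k) (a : kmor R S) (V : lmodType S) r
  (v : restr a V) : r *: v = a r *: (v : V) :> V.
Proof. by []. Qed.

Record subm_data (K : pzRingType) := SubmData {
  subm_mod : lmodType K;
  subm_pred : subm_mod -> Prop;
  subm_pred0 : subm_pred 0;
  subm_predD : forall x y, subm_pred x -> subm_pred y -> subm_pred (x + y);
  subm_predN : forall x, subm_pred x -> subm_pred (- x);
  subm_predZ : forall a x, subm_pred x -> subm_pred (a *: x) }.

Definition subm K (d : subm_data K) : Type := {x : subm_mod d | subm_pred x}.
HB.instance Definition _ K (d : subm_data K) := gen_eqMixin (subm d).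
HB.instance Definition _ K (d : subm_data K) := gen_choiceMixin (subm d).

Section Submodule.
Variables (K : pzRingType) (d : subm_data K).

Lemma sval_inj : injective (@sval _ _ : subm d -> subm_mod d).
Proof.
case=> x hx [y hy] /= e; apply: eq_exist_uncurried; exists e; exact: Prop_irrelevance.
Qed.

Definition subm_add (x y : subm d) : subm d := exist _ _ (subm_predD (svalP x) (svalP y)).
Definition subm_opp (x : subm d) : subm d := exist _ _ (subm_predN (svalP x)).
Definition subm_scale a (x : subm d) : subm d := exist _ _ (subm_predZ a (svalP x)).
Definition subm_zero : subm d := exist _ _ (subm_pred0 d).

Lemma subm_addA : associative subm_add.
Proof. by move=> x y z; apply: sval_inj; rewrite /= addrA. Qed.
Lemma subm_addC : commutative subm_add.
Proof. by move=> x y; apply: sval_inj; rewrite /= addrC. Qed.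
Lemma subm_add0 : left_id subm_zero subm_add.
Proof. by move=> x; apply: sval_inj; rewrite /= add0r. Qed.
Lemma subm_addN : left_inverse subm_zero subm_opp subm_add.
Proof. by move=> x; apply: sval_inj; rewrite /= addNr. Qed.
End Submodule.

HB.instance Definition _ K (d : subm_data K) :=
  GRing.isZmodule.Build (subm d) (@subm_addA K d) (@subm_addC K d) (@subm_add0 K d)
    (@subm_addN K d).

Section SubmoduleLmod.
Variables (K : pzRingType) (d : subm_data K).
Lemma subm_scaleA a b (v : subm d) : subm_scale a (subm_scale b v) = subm_scale (a * b) v.
Proof. by apply: sval_inj; rewrite /= scalerA. Qed.
Lemma subm_scale1 : left_id 1 (@subm_scale K d).
Proof. by move=> v; apply: sval_inj; rewrite /= scale1r. Qed.
Lemma subm_scaleDr : right_distributive (@subm_scale K d) +%R.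
Proof. by move=> a u v; apply: sval_inj; rewrite /= scalerDr. Qed.
Lemma subm_scaleDl (v : subm d) : {morph (@subm_scale K d)^~ v : a b / a + b}.
Proof. by move=> a b; apply: sval_inj; rewrite /= scalerDl. Qed.
End SubmoduleLmod.

HB.instance Definition _ K (d : subm_data K) :=
  GRing.Zmodule_isLmodule.Build K (subm d) (@subm_scaleA K d) (@subm_scale1 K d)
    (@subm_scaleDr K d) (@subm_scaleDl K d).

Lemma sval_linear (k : comPzRingType) (R : kalg k) (d : subm_data R) :
  slinear (kid R) (@sval _ _ : subm d -> subm_mod d).
Proof. by []. Qed.

Section Cokernel.
Variables (K : pzRingType) (V W : lmodType K) (f : W -> V)
  (fD : forall x y, f (x + y) = f x + f y) (fZ : forall a x, f (a *: x) = a *: f x).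

Let f0 : f 0 = 0. Proof. by apply: (addIr (f 0)); rewrite -fD !add0r. Qed.
Let fN x : f (- x) = - f x. Proof. by apply: (addIr (f x)); rewrite -fD !addNr f0. Qed.

Definition coker_rel (x y : V) := exists m, x - y = f m.

Let coker_rel_eq x y : x = y -> coker_rel x y.
Proof. by move=> ->; exists 0; rewrite subrr f0. Qed.

Definition coker_data : quot_data K.
refine (@QuotData K V coker_rel 0 +%R -%R *:%R _ _ _ _ _ _ _ _ _ _ _ _ _ _).
- by move=> x; apply: coker_rel_eq.
- by move=> x y [m e]; exists (- m); rewrite fN -e opprB.
- by move=> x y z [m e] [m' e']; exists (m + m'); rewrite fD -e -e' addrA subrK.
- by move=> x x' y y' [m e] [m' e']; exists (m + m'); rewrite fD -e -e' opprD addrACA.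
- by move=> x x' [m e]; exists (- m); rewrite fN -e opprB opprK addrC.
- by move=> a x x' [m e]; exists (a *: m); rewrite fZ -e scalerBr.
- by move=> x y z; apply: coker_rel_eq; rewrite addrA.
- by move=> x y; apply: coker_rel_eq; rewrite addrC.
- by move=> x; apply: coker_rel_eq; rewrite add0r.
- by move=> x; apply: coker_rel_eq; rewrite addNr.
- by move=> a b x; apply: coker_rel_eq; rewrite scalerA.
- by move=> x; apply: coker_rel_eq; rewrite scale1r.
- by move=> a x y; apply: coker_rel_eq; rewrite scalerDr.
- by move=> a b x; apply: coker_rel_eq; rewrite scalerDl.
Defined.

Definition coker : lmodType K := quot coker_data.
Definition coker_pr (x : V) : coker := @qclass _ coker_data x.

Lemma coker_prD x y : coker_pr (x + y) = coker_pr x + coker_pr y.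
Proof. by rewrite /coker_pr qclassD. Qed.
Lemma coker_prZ a x : coker_pr (a *: x) = a *: coker_pr x.
Proof. by rewrite /coker_pr qclassZ. Qed.
Lemma coker_pr_surj q : exists x, q = coker_pr x.
Proof. exact: (@qclass_surj _ coker_data). Qed.
Lemma coker_pr_eq0 x : coker_pr x = 0 -> exists m, x = f m.
Proof. by move=> /qclass_eqP [m e]; exists m; rewrite -e subr0. Qed.
Lemma coker_pr_im m : coker_pr (f m) = 0.
Proof. by rewrite -qclass0; apply: qclass_eq; exists m; rewrite subr0. Qed.
End Cokernel.

(** * A commutative ring of endomorphisms *)

Definition additive_fun (V : zmodType) (f : V -> V) := forall x y, f (x + y) = f x + f y.

Definition commutant (V : zmodType) (Z : (V -> V) -> Prop) (psi : V -> V) :=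
  additive_fun psi /\ forall phi, Z phi -> forall y, psi (phi y) = phi (psi y).

(* The bicommutant of a set of pairwise commuting additive endomorphisms is a
   commutative ring containing it.  This is how [S (x)_R S] is made to act on
   [MS (x)_R S] below: [ring_tensor] only provides maps into commutative
   [k]-algebras. *)
Record comm_family := CommFamily {
  cf_car : zmodType;
  cf_mem : (cf_car -> cf_car) -> Prop;
  cf_commutative : forall phi, cf_mem phi -> commutant cf_mem phi }.

Definition bicommutant (d : comm_family) := commutant (commutant (@cf_mem d)).

Definition bicomm (d : comm_family) : Type := {f : cf_car d -> cf_car d | bicommutant f}.
HB.instance Definition _ (d : comm_family) := gen_eqMixin (bicomm d).
HB.instance Definition _ (d : comm_family) := gen_choiceMixin (bicomm d).

Section Bicommutant.
Variable d : comm_family.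
Local Notation V := (cf_car d).

Lemma bicomm_inj (x y : bicomm d) : sval x =1 sval y -> x = y.
Proof.
case: x y => x hx [y hy] /= /funext e; apply: eq_exist_uncurried; exists e.
exact: Prop_irrelevance.
Qed.

Lemma additive_fun0 (f : V -> V) : additive_fun f -> f 0 = 0.
Proof. by move=> h; apply: (addIr (f 0)); rewrite -h !add0r. Qed.
Lemma additive_funN (f : V -> V) : additive_fun f -> forall x, f (- x) = - f x.
Proof. by move=> h x; apply: (addIr (f x)); rewrite -h !addNr additive_fun0. Qed.

Lemma bicommutant0 : @bicommutant d (fun _ => 0).
Proof. by split=> [x y|psi [psiD _] y /=]; rewrite ?addr0 ?additive_fun0. Qed.
Lemma bicommutantD f g : bicommutant f -> bicommutant g -> @bicommutant d (fun x => f x + g x).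
Proof.
move=> [fD fC] [gD gC]; split=> [x y|psi hpsi y /=]; first by rewrite fD gD addrACA.
by rewrite (fC _ hpsi) (gC _ hpsi) /= hpsi.1.
Qed.
Lemma bicommutantN f : bicommutant f -> @bicommutant d (fun x => - f x).
Proof.
move=> [fD fC]; split=> [x y|psi hpsi y /=]; first by rewrite fD opprD.
by rewrite (fC _ hpsi) /= (additive_funN hpsi.1).
Qed.
Lemma bicommutant1 : @bicommutant d id.
Proof. by []. Qed.
Lemma bicommutantM f g : bicommutant f -> bicommutant g -> @bicommutant d (f \o g).
Proof.
move=> [fD fC] [gD gC]; split=> [x y|psi hpsi y] /=; first by rewrite gD fD.
by rewrite (gC _ hpsi) (fC _ hpsi).
Qed.
Lemma mem_bicommutant phi : cf_mem phi -> @bicommutant d phi.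
Proof.
by move=> h; split=> [|psi [_ psiC] y]; [exact: (cf_commutative h).1 | rewrite psiC].
Qed.
Lemma bicommutant_commutant f : @bicommutant d f -> commutant (@bicommutant d) f.
Proof.
move=> [fD fC]; split=> // g [_ gC] y.
by rewrite /= gC //; split; [exact: fD | move=> phi /cf_commutative /fC].
Qed.

Definition bicomm_add (x y : bicomm d) : bicomm d := exist _ _ (bicommutantD (svalP x) (svalP y)).
Definition bicomm_opp (x : bicomm d) : bicomm d := exist _ _ (bicommutantN (svalP x)).
Definition bicomm_mul (x y : bicomm d) : bicomm d := exist _ _ (bicommutantM (svalP x) (svalP y)).
Definition bicomm_zero : bicomm d := exist _ _ bicommutant0.
Definition bicomm_one : bicomm d := exist _ _ bicommutant1.

Lemma bicomm_addA : associative bicomm_add.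
Proof. by move=> x y z; apply: bicomm_inj => v /=; rewrite addrA. Qed.
Lemma bicomm_addC : commutative bicomm_add.
Proof. by move=> x y; apply: bicomm_inj => v /=; rewrite addrC. Qed.
Lemma bicomm_add0 : left_id bicomm_zero bicomm_add.
Proof. by move=> x; apply: bicomm_inj => v /=; rewrite add0r. Qed.
Lemma bicomm_addN : left_inverse bicomm_zero bicomm_opp bicomm_add.
Proof. by move=> x; apply: bicomm_inj => v /=; rewrite addNr. Qed.
Lemma bicomm_mulA : associative bicomm_mul.
Proof. by move=> x y z; apply: bicomm_inj. Qed.
Lemma bicomm_mulC : commutative bicomm_mul.
Proof. by move=> [x hx] [y hy]; apply: bicomm_inj => v /=; rewrite (bicommutant_commutant hx).2. Qed.
Lemma bicomm_mul1 : left_id bicomm_one bicomm_mul.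
Proof. by move=> x; apply: bicomm_inj. Qed.
Lemma bicomm_mulDl : left_distributive bicomm_mul bicomm_add.
Proof. by move=> x y z; apply: bicomm_inj. Qed.
End Bicommutant.

HB.instance Definition _ (d : comm_family) :=
  GRing.isZmodule.Build (bicomm d) (@bicomm_addA d) (@bicomm_addC d) (@bicomm_add0 d)
    (@bicomm_addN d).
HB.instance Definition _ (d : comm_family) :=
  GRing.Zmodule_isComPzRing.Build (bicomm d) (@bicomm_mulA d) (@bicomm_mulC d)
    (@bicomm_mul1 d) (@bicomm_mulDl d).

Definition bicomm_of (d : comm_family) (phi : cf_car d -> cf_car d) (h : cf_mem phi) : bicomm d :=
  exist _ phi (mem_bicommutant h).

Section BicommModule.
Variables (d : comm_family) (K : comPzRingType) (h : K -> bicomm d) (hh : rhom h).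

Definition bicomm_mod (_ : rhom h) : Type := cf_car d.
Local Notation Y := (bicomm_mod hh).
HB.instance Definition _ := GRing.Zmodule.on Y.

Definition bicomm_act (s : K) (v : Y) : Y := sval (h s) v.

Lemma bicomm_actA s t v : bicomm_act s (bicomm_act t v) = bicomm_act (s * t) v.
Proof. by have [_ hM _] := hh; rewrite /bicomm_act hM. Qed.
Lemma bicomm_act1 : left_id 1 bicomm_act.
Proof. by have [_ _ h1] := hh => v; rewrite /bicomm_act h1. Qed.
Lemma bicomm_actDr : right_distributive bicomm_act +%R.
Proof. by move=> s u v; apply: (svalP (h s)).1. Qed.
Lemma bicomm_actDl v : {morph bicomm_act^~ v : s t / s + t}.
Proof. by have [hD _ _] := hh => s t; rewrite /bicomm_act hD. Qed.

HB.instance Definition _ := GRing.Zmodule_isLmodule.Build K Y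
  bicomm_actA bicomm_act1 bicomm_actDr bicomm_actDl.

Lemma bicomm_modZ s (v : Y) : s *: v = sval (h s) v.
Proof. by []. Qed.
End BicommModule.

(** * Faithfully flat descent for modules *)

Section FaithfullyFlat.
Variables (k : comPzRingType) (R S : kalg k) (alpha : kmor R S) (Hff : faithfully_flat alpha).

Lemma ff_bc_inj (M : lmodType R) (MS : lmodType S) (jM : M -> MS) :
  mod_bc alpha jM -> injective jM.
Proof.
move=> HjM; have hjM := HjM.1.
have kerD x y : jM x = 0 -> jM y = 0 -> jM (x + y) = 0.
  by rewrite (slinearD hjM) => -> ->; rewrite addr0.
have kerN x : jM x = 0 -> jM (- x) = 0 by rewrite (slinearN hjM) => ->; rewrite oppr0.
have kerZ r x : jM x = 0 -> jM (r *: x) = 0 by rewrite (slinearZ hjM) => ->; rewrite scaler0.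
pose K := @SubmData R M (fun x => jM x = 0) (slinear0 hjM) kerD kerN kerZ.
(* [K (x) S -> M (x) S] is injective by flatness, and zero. *)
have K_S0 (t : tensor alpha (subm K)) : t = 0.
  apply: (Hff.1 _ _ _ (sval_linear K) (@sval_inj _ K) _ _ _ _ (tensor_bc alpha _) HjM
    (fun _ => 0)) => [|m|//]; last by rewrite (svalP m).
  by split=> [x y|r x]; rewrite ?addr0 ?scaler0.
have K0 := Hff.2 _ _ _ (tensor_bc alpha (subm K)) K_S0.
move=> x y e; have hxy : jM (x - y) = 0 by rewrite (slinearB hjM) e subrr.
by apply/subr0_eq; exact: (congr1 sval (K0 (exist _ _ hxy))).
Qed.

(* The span hypothesis says that the base change of [f] is onto. *)
Lemma ff_surj (M N : lmodType R) (f : M -> N) (NS : lmodType S) (jN : N -> NS) :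
  slinear (kid R) f -> mod_bc alpha jN ->
  (forall n, exists r, jN n = lincomb (fun m => jN (f m)) r) ->
  forall n, exists m, f m = n.
Proof.
move=> hf HjN span n.
pose Q := coker (slinearD hf) (slinearZ hf).
pose pr := coker_pr (slinearD hf) (slinearZ hf).
have hjQ := tensor_in_slinear alpha Q.
have [pQ [hpQ pQE]] : {pQ : NS -> tensor alpha Q |
    slinear (kid S) pQ /\ forall n, pQ (jN n) = tensor_in alpha (pr n)}.
  apply: (mod_bc_lift HjN).
  by split=> [x y|r x]; rewrite /pr ?coker_prD ?coker_prZ ?(slinearD hjQ) ?(slinearZ hjQ).
have Q_S0 (t : tensor alpha Q) : t = 0.
  have [r ->] := mod_bc_span (tensor_bc alpha Q) t.
  apply: lincomb_eq0 => q; have [y ->] := coker_pr_surj q.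
  have [r' ry] := span y; rewrite -[tensor_in _ _]pQE ry (linear_lincomb hpQ).
  by apply: lincomb_eq0 => m; rewrite pQE /pr coker_pr_im (slinear0 hjQ).
have [m nm] := coker_pr_eq0 (Hff.2 _ _ _ (tensor_bc alpha Q) Q_S0 (pr n)).
by exists m.
Qed.
End FaithfullyFlat.

Section Descent.
Variables (k : comPzRingType) (R S S2 : kalg k) (alpha : kmor R S) (a1 a2 : kmor S S2)
  (HS2 : ring_tensor alpha a1 a2) (Hff : faithfully_flat alpha)
  (M : lmodType R) (MS : lmodType S) (jM : M -> MS) (HjM : mod_bc alpha jM)
  (MS2 : lmodType S2) (jM2 : M -> MS2) (HjM2 : mod_bc (kcomp alpha a1) jM2)
  (e1 e2 : MS -> MS2)
  (He1 : slinear a1 e1 /\ forall m, e1 (jM m) = jM2 m)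
  (He2 : slinear a2 e2 /\ forall m, e2 (jM m) = jM2 m).

Local Notation MSR := (restr alpha MS).
Local Notation T := (tensor alpha MSR).
Local Notation j' := (@tensor_in _ _ _ alpha MSR).
Let hj' : slinear alpha j' := tensor_in_slinear alpha MSR.
Let HT : mod_bc alpha j' := tensor_bc alpha MSR.

(* On [T = MS (x)_R S], [lam s] multiplies the left factor by [s] and [rho s]
   the right one. *)
Lemma lam_subproof (s : S) : slinear alpha (fun y : MSR => j' (s *: (y : MS) : MS)).
Proof.
split=> [x y|r x]; rewrite -?(slinearD hj') -?(slinearZ hj'); congr j'.
  by rewrite scalerDr.
by rewrite !restrZ !scalerA mulrC.
Qed.

Definition lam (s : S) : T -> T := sval (mod_bc_lift HT (lam_subproof s)).
Definition rho (s : S) (t : T) : T := s *: t.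

Lemma lam_linear s : slinear (kid S) (lam s).
Proof. exact: (svalP (mod_bc_lift HT (lam_subproof s))).1. Qed.
Lemma lamE s (y : MS) : lam s (j' y) = j' (s *: y : MS).
Proof. exact: (svalP (mod_bc_lift HT (lam_subproof s))).2. Qed.
Lemma rho_linear s : slinear (kid S) (rho s).
Proof. by split=> [x y|r x]; rewrite /rho ?scalerDr // !scalerA mulrC. Qed.

Lemma lam_comm s t x : lam s (lam t x) = lam t (lam s x).
Proof.
have lamM s' t' : slinear (kid S) (fun x => lam s' (lam t' x)).
  exact: (slinear_comp (lam_linear t') (lam_linear s')).
by apply: (mod_bc_ext HT (lamM s t) (lamM t s)) => m; rewrite !lamE !scalerA mulrC.
Qed.

Definition lam_rho_mem (phi : T -> T) : Prop := exists s, phi = lam s \/ phi = rho s.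

Lemma lam_rho_commutative phi : lam_rho_mem phi -> commutant lam_rho_mem phi.
Proof.
case=> s [->|->]; split=> [x y|psi [t [->|->]] y]; rewrite /rho.
- exact: (slinearD (lam_linear s)).
- exact: lam_comm.
- by rewrite (slinearZ (lam_linear s)).
- by rewrite scalerDr.
- by rewrite (slinearZ (lam_linear t)).
- by rewrite !scalerA mulrC.
Qed.

Definition lam_rho_family := CommFamily lam_rho_commutative.

Lemma mem_lam s : lam_rho_mem (lam s). Proof. by exists s; left. Qed.
Lemma mem_rho s : lam_rho_mem (rho s). Proof. by exists s; right. Qed.

Definition lamC (s : S) := @bicomm_of lam_rho_family _ (mem_lam s).
Definition rhoC (s : S) := @bicomm_of lam_rho_family _ (mem_rho s).

Lemma rhoC_rhom : rhom rhoC.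
Proof.
by split=> [s t|s t|]; apply: bicomm_inj => v /=; rewrite /rho ?scalerDl ?scalerA ?scale1r.
Qed.

Lemma lamC_rhom : rhom lamC.
Proof.
have eqC (f g : bicomm lam_rho_family) : slinear (kid S) (sval f) ->
    slinear (kid S) (sval g) -> (forall y, sval f (j' y) = sval g (j' y)) -> f = g.
  by move=> hf hg e; apply/bicomm_inj/(mod_bc_ext HT hf hg e).
have linD s t : slinear (kid S) (fun v => lam s v + lam t v).
  split=> [x y|r x]; first by rewrite !(slinearD (lam_linear _)) addrACA.
  by rewrite !(slinearZ (lam_linear _)) scalerDr.
split=> [s t|s t|]; apply: eqC => [||y] /=; rewrite ?lamE //; try exact: lam_linear.
- rewrite scalerDl; exact: slinearD hj' _ _.
- exact: slinear_comp (lam_linear _) (lam_linear _) _.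
- by rewrite scalerA.
- by rewrite scale1r.
Qed.

Lemma lamC_alpha r : lamC (alpha r) = rhoC (alpha r).
Proof.
apply: bicomm_inj; apply: (mod_bc_ext HT (lam_linear _) (rho_linear _)) => m.
by rewrite lamE /rho -(slinearZ hj').
Qed.

Lemma kstr_rhoC_rhom : rhom (fun c => rhoC (kstr S c)).
Proof.
case: (kstr_rhom S) => sD sM s1; case: rhoC_rhom => rD rM r1.
by split=> [x y|x y|]; rewrite ?sD ?rD ?sM ?rM ?s1 ?r1.
Qed.

Definition lam_rho_kalg : kalg k := @KAlg k (bicomm lam_rho_family) _ kstr_rhoC_rhom.
Lemma lamC_k c : lamC (kstr S c) = kstr lam_rho_kalg c.
Proof. by rewrite /= -(kfun_k alpha) lamC_alpha. Qed.
Definition lamK : kmor S lam_rho_kalg := @KMor k S lam_rho_kalg lamC lamC_rhom lamC_k.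
Definition rhoK : kmor S lam_rho_kalg := @KMor k S lam_rho_kalg rhoC rhoC_rhom (fun c => erefl).

Lemma tensor_in_equalizer x r : e1 x = e2 x -> x = lincomb jM r ->
  j' x = lincomb (fun m => j' (jM m)) r.
Proof.
have [_ /(_ _ lamK rhoK lamC_alpha) [h [h1 h2 _]]] := HS2.
pose Y := bicomm_mod (kfun_rhom h).
have hjM := HjM.1.
have [chi [hchi chiE]] : {chi : MS2 -> Y | slinear (kid S2) chi /\
    forall m, chi (jM2 m) = j' (jM m) :> T}.
  apply: (mod_bc_lift HjM2).
  split=> [m m'|c m]; first by rewrite (slinearD hjM) (slinearD hj').
  by rewrite bicomm_modZ /= h1 /= lamE (slinearZ hjM).
have chi_e1 (y : MS) : chi (e1 y) = j' y :> T.
  apply: (mod_bc_ext (phi := a1) HjM (slinear_comp He1.1 hchi _)) => [//||m].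
    by split=> [y' z|s y']; rewrite /= ?(slinearD hj') // bicomm_modZ h1 /= lamE.
  by rewrite He1.2 chiE.
have chi_e2 r' : chi (e2 (lincomb jM r')) = lincomb (fun m => j' (jM m)) r' :> T.
  elim: r' => [|p r' IH]; first by rewrite !lincomb_nil (slinear0 He2.1) (slinear0 hchi).
  rewrite !lincomb_cons (slinearD He2.1) (slinearD hchi) IH (slinearZ He2.1) (slinearZ hchi).
  by rewrite He2.2 chiE bicomm_modZ h2.
by move=> ex xE; rewrite -chi_e1 ex {1}xE chi_e2.
Qed.

Lemma mod_bc_equalizer x : e1 x = e2 x <-> exists m, jM m = x.
Proof.
split=> [ex|[m <-]]; last by rewrite He1.2 He2.2.
have hjM := HjM.1.
have eqD (y z : MSR) : e1 y = e2 y -> e1 z = e2 z -> e1 (y + z) = e2 (y + z).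
  by rewrite (slinearD He1.1) (slinearD He2.1) => -> ->.
have eqN (y : MSR) : e1 y = e2 y -> e1 (- y) = e2 (- y).
  by rewrite (slinearN He1.1) (slinearN He2.1) => ->.
have eqZ c (y : MSR) : e1 y = e2 y -> e1 (c *: y) = e2 (c *: y).
  by rewrite restrZ (slinearZ He1.1) (slinearZ He2.1) (proj1 HS2) => ->.
have eq0 : e1 (0 : MSR) = e2 0 by rewrite (slinear0 He1.1) (slinear0 He2.1).
pose E := @SubmData R MSR (fun y => e1 y = e2 y) eq0 eqD eqN eqZ.
pose em m : subm E := exist _ (jM m : MSR) (etrans (He1.2 m) (esym (He2.2 m))).
have hem : slinear (kid R) em.
  by split=> [m m'|c m]; apply: sval_inj; rewrite /= ?(slinearD hjM) ?(slinearZ hjM).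
have [g [hg gE]] := mod_bc_lift (tensor_bc alpha (subm E))
  (slinear_comp (sval_linear E) hj' (fun=> erefl)).
(* [E (x) S -> MS (x) S] is injective by flatness. *)
have g_inj : injective g.
  exact: (Hff.1 _ _ _ (sval_linear E) (@sval_inj _ E) _ _ _ _ (tensor_bc _ _) HT g hg gE).
have span (y : subm E) : exists r, tensor_in alpha y = lincomb (fun m => tensor_in alpha (em m)) r.
  have [r yE] := mod_bc_span HjM (sval y); exists r; apply: g_inj.
  rewrite gE (linear_lincomb hg) (tensor_in_equalizer (svalP y) yE).
  by apply: eq_bigr => p _; rewrite gE.
have [m /(congr1 sval) /= mx] := ff_surj Hff hem (tensor_bc alpha (subm E)) span (exist _ x ex).
by exists m.
Qed.
End Descent.

(** * Algebras and the functor *)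

Section AlgebraProduct.
Variables (R : comPzRingType) (A : ralg R).

Lemma amulDl1 (x y z : A) : amul (x + y) z = amul x z + amul y z.
Proof. by rewrite -{1}[x]scale1r amulDl scale1r. Qed.
Lemma amulDr1 (x y z : A) : amul z (x + y) = amul z x + amul z y.
Proof. by rewrite -{1}[x]scale1r amulDr scale1r. Qed.
Lemma amul0l (z : A) : amul 0 z = 0.
Proof. by apply: (addIr (amul 0 z)); rewrite -amulDl1 !add0r. Qed.
Lemma amul0r (z : A) : amul z 0 = 0.
Proof. by apply: (addIr (amul z 0)); rewrite -amulDr1 !add0r. Qed.
Lemma amulZl r (x z : A) : amul (r *: x) z = r *: amul x z.
Proof. by rewrite -[r *: x]addr0 amulDl amul0l addr0. Qed.
Lemma amulZr r (x z : A) : amul z (r *: x) = r *: amul z x.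
Proof. by rewrite -[r *: x]addr0 amulDr amul0r addr0. Qed.
End AlgebraProduct.

Section AlgebraBaseChange.
Variables (k : comPzRingType) (R T T' : kalg k) (a : kmor R T) (b : kmor T T') (c : kmor R T')
  (A : ralg R) (X : ralg T) (iX : ahom a A X) (hX : alg_bc iX) (Y : ralg T').

Lemma alg_bc_mul (f : X -> Y) (G : ahom c A Y) : slinear b f -> (forall x, f (iX x) = G x) ->
  forall x y, f (amul x y) = amul (f x) (f y).
Proof.
move=> hf fG.
have lin_l z : slinear b (fun y => f (amul z y)).
  by split=> [y y'|s y]; rewrite ?amulDr1 ?amulZr ?(slinearD hf) ?(slinearZ hf).
have lin_r z : slinear b (fun y => amul (f z) (f y)).
  by split=> [y y'|s y]; rewrite ?(slinearD hf) ?(slinearZ hf) ?amulDr1 ?amulZr.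
have mul_iX x : forall y, f (amul (iX x) y) = amul (f (iX x)) (f y).
  apply: (mod_bc_ext hX (lin_l _) (lin_r _)) => y.
  by rewrite -(afun_mul iX) !fG (afun_mul G).
move=> x y; move: x; apply: (mod_bc_ext hX) => [||x]; last exact: mul_iX.
  by split=> [x x'|s x]; rewrite ?amulDl1 ?amulZl ?(slinearD hf) ?(slinearZ hf).
by split=> [x x'|s x]; rewrite ?(slinearD hf) ?(slinearZ hf) ?amulDl1 ?amulZl.
Qed.

Definition alg_bc_ahom (f : X -> Y) (G : ahom c A Y) (hf : slinear b f)
  (fG : forall x, f (iX x) = G x) : ahom b X Y := AHom hf (alg_bc_mul hf fG).
End AlgebraBaseChange.

Definition ahom_id (k : comPzRingType) (R : kalg k) (A : ralg R) : ahom (kid R) A A :=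
  @AHom k R R (kid R) A A id (conj (fun x y => erefl) (fun r x => erefl)) (fun x y => erefl).

Definition ahom_comp (k : comPzRingType) (R S T : kalg k) (a : kmor R S) (b : kmor S T)
  (A : ralg R) (B : ralg S) (C : ralg T) (f : ahom a A B) (g : ahom b B C) :
  ahom (kcomp a b) A C :=
  @AHom k R T (kcomp a b) A C (fun x => g (f x))
    (slinear_comp (afun_slin f) (afun_slin g) (fun r => erefl))
    (fun x y => etrans (congr1 g (afun_mul f x y)) (afun_mul g _ _)).

Lemma ahom_inv (k : comPzRingType) (R : kalg k) (A B : ralg R) (f : ahom (kid R) A B) :
  bijective f -> exists g : ahom (kid R) B A, cancel f g /\ cancel g f.
Proof.
case=> g fK gK.
have gM x y : g (amul x y) = amul (g x) (g y).
  by apply: (can_inj fK); rewrite (afun_mul f) !gK.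
by exists (AHom (slinear_can (afun_slin f) fK gK) gM).
Qed.

Section Functor.
Variables (k : comPzRingType) (F : kfunctor k).

Lemma FM_comm (R S S' T : kalg k) (a : kmor R S) (b : kmor S T) (a' : kmor R S')
  (b' : kmor S' T) (A : ralg R) (B : ralg S) (B' : ralg S') (C : ralg T)
  (f : ahom a A B) (g : ahom b B C) (f' : ahom a' A B') (g' : ahom b' B' C) :
  (forall r, b (a r) = b' (a' r)) -> (forall x, g (f x) = g' (f' x)) ->
  forall m, FM F g (FM F f m) = FM F g' (FM F f' m).
Proof.
move=> hab hfg m; pose h := ahom_comp f g.
by rewrite -(FM_comp (h := h) (fun=> erefl) (fun=> erefl)) (FM_comp (h := h) hab hfg).
Qed.

Lemma FM_can (R : kalg k) (A B : ralg R) (f : ahom (kid R) A B) (g : ahom (kid R) B A) :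
  cancel f g -> cancel (FM F f) (FM F g).
Proof.
move=> fK m; pose i := ahom_id A.
by rewrite -(FM_comp (f := f) (g := g) (h := i) (fun=> erefl) (fun x => esym (fK x))) (FM_id (f := i)).
Qed.

Definition nu_spec (R T : kalg k) (b : kmor R T) (A : ralg R) (AT : ralg T) (i : ahom b A AT)
  (X : lmodType T) (j : FO F A -> X) (v : X -> FO F AT) :=
  slinear (kid T) v /\ forall m, v (j m) = FM F i m.

Lemma stable_bc_nu (HF : stable_bc F) (R T : kalg k) (b : kmor R T) (A : ralg R)
  (AT : ralg T) (i : ahom b A AT) (X : lmodType T) (j : FO F A -> X) :
  alg_bc i -> mod_bc b j -> exists2 nu : X -> FO F AT, nu_spec i j nu & bijective nu.
Proof.
move=> hi hj; have [nu [hnu nuE]] := mod_bc_lift hj (FM_slin F i).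
by exists nu; [split | apply: HF hi _ _ hj _ hnu nuE].
Qed.

Lemma FM_nu_natural (R T T' : kalg k) (a : kmor R T) (b : kmor T T') (c : kmor R T')
  (A : ralg R) (AT : ralg T) (AT' : ralg T') (iT : ahom a A AT) (iT' : ahom c A AT')
  (E : ahom b AT AT') (X : lmodType T) (Y : lmodType T') (jX : FO F A -> X)
  (jY : FO F A -> Y) (v : X -> FO F AT) (w : Y -> FO F AT') (d : X -> Y) :
  (forall r, c r = b (a r)) -> (forall x, E (iT x) = iT' x) -> mod_bc a jX ->
  nu_spec iT jX v -> nu_spec iT' jY w -> slinear b d /\ (forall m, d (jX m) = jY m) ->
  forall x, FM F E (v x) = w (d x).
Proof.
move=> hc EiT HjX [hv vE] [hw wE] [hd dE].
apply: (mod_bc_ext HjX (slinear_comp hv (FM_slin F E) (fun=> erefl))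
  (slinear_comp hd hw (fun=> erefl))) => m.
rewrite vE dE wE; symmetry.
exact: (FM_comp (f := iT) (g := E) hc (fun x => esym (EiT x))).
Qed.

Lemma FM_iso_transport (S : kalg k) (AS BS : ralg S) (theta : ahom (kid S) AS BS)
  (thetai : ahom (kid S) BS AS) (X Y : lmodType S) (vA : X -> FO F AS) (vB : Y -> FO F BS) :
  cancel theta thetai -> cancel thetai theta -> slinear (kid S) vA -> bijective vA ->
  slinear (kid S) vB -> bijective vB ->
  exists Phi : X -> Y, [/\ slinear (kid S) Phi, bijective Phi & forall x, vB (Phi x) = FM F theta (vA x)].
Proof.
move=> thetaK thetaiK hvA [vAi vAK vAiK] hvB [vBi vBK vBiK].
exists (fun x => vBi (FM F theta (vA x))); split=> [||x]; last by rewrite vBiK.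
  exact: slinear_comp (slinear_comp hvA (FM_slin F theta) (fun=> erefl))
    (slinear_can hvB vBK vBiK) (fun=> erefl).
by exists (fun y => vAi (FM F thetai (vB y))) => [x|y]; rewrite ?vBiK ?vAiK FM_can ?vAK ?vBK.
Qed.
End Functor.

Lemma bc_descent_maps (k : comPzRingType) (R S S2 : kalg k) (alpha : kmor R S)
  (a1 a2 : kmor S S2) (hcomm : forall r, a1 (alpha r) = a2 (alpha r))
  (N : lmodType R) (NS : lmodType S) (jN : N -> NS) :
  mod_bc alpha jN ->
  exists (NS2 : lmodType S2) (jN2 : N -> NS2) (e1 e2 : NS -> NS2),
    [/\ mod_bc (kcomp alpha a1) jN2,
        slinear a1 e1 /\ (forall n, e1 (jN n) = jN2 n) &
        slinear a2 e2 /\ (forall n, e2 (jN n) = jN2 n)].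
Proof.
move=> HjN; pose NS2 := tensor (kcomp alpha a1) N.
have hj2 := tensor_in_slinear (kcomp alpha a1) N.
have [e1 [he1 e1E]] : {e1 : NS -> restr a1 NS2 | slinear (kid S) e1 /\
    forall n, e1 (jN n) = tensor_in (kcomp alpha a1) n}.
  by apply: (mod_bc_lift HjN); split=> [n n'|r n]; [exact: (slinearD hj2) | exact: (slinearZ hj2)].
have [e2 [he2 e2E]] : {e2 : NS -> restr a2 NS2 | slinear (kid S) e2 /\
    forall n, e2 (jN n) = tensor_in (kcomp alpha a1) n}.
  apply: (mod_bc_lift HjN); split=> [n n'|r n]; first exact: (slinearD hj2).
  by rewrite (slinearZ hj2) restrZ /= hcomm.
by exists NS2, (@tensor_in _ _ _ (kcomp alpha a1) N), e1, e2; split; [exact: tensor_bc | |].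
Qed.

Lemma alg_bc_iso_retraction (k : comPzRingType) (R S S' : kalg k) (a : kmor R S)
  (b : kmor S S') (c : kmor R S') (hc : forall r, c r = b (a r))
  (A B : ralg R) (AS BS : ralg S) (AS' BS' : ralg S')
  (iAS' : ahom c A AS') (iBS : ahom a B BS) (iBS' : ahom c B BS') (iAS : A -> AS)
  (hAS' : alg_bc iAS') (hBS : alg_bc iBS) (hBS' : alg_bc iBS')
  (theta : ahom (kid S) AS BS) (thetai : ahom (kid S) BS AS) (theta' : ahom (kid S') AS' BS')
  (eA : ahom b AS AS') (eB : BS -> BS') :
  cancel theta thetai -> (forall x, eA (iAS x) = iAS' x) ->
  slinear b eB -> (forall x, eB (iBS x) = iBS' x) -> (forall x, theta' (eA x) = eB (theta x)) ->
  exists g : ahom (kid S') BS' AS', cancel theta' g.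
Proof.
move=> thetaK eAE heB eBE theta'E.
pose G := ahom_comp (ahom_comp iBS thetai) eA.
have [t [ht tE]] := mod_bc_lift hBS'
  (slinear_comp (afun_slin (ahom_comp iBS thetai)) (afun_slin eA) hc).
have teB y : t (eB y) = eA (thetai y).
  apply: (mod_bc_ext hBS (slinear_comp heB ht (fun=> erefl))
    (slinear_comp (afun_slin thetai) (afun_slin eA) (fun=> erefl))) => x.
  by rewrite eBE tE.
exists (alg_bc_ahom hBS' (G := G) ht tE) => x /=.
apply: (mod_bc_ext hAS' (slinear_comp (afun_slin theta') ht (fun=> erefl))
  (afun_slin (ahom_id AS'))) => m.
by rewrite -eAE theta'E teB thetaK.
Qed.
Theorem theorem2p9
  (k : comPzRingType) (R S : kalg k) (alpha : kmor R S)
  (Hff : faithfully_flat alpha)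
  (A B : ralg R)
  (* A (x)_R S and B (x)_R S with alpha^A, alpha^B *)
  (AS : ralg S) (iAS : ahom alpha A AS) (HAS : alg_bc iAS)
  (BS : ralg S) (iBS : ahom alpha B BS) (HBS : alg_bc iBS)
  (theta : ahom (kid S) AS BS) (Htheta : bijective theta)
  (* S'' = S (x)_R S with alpha_1, alpha_2 *)
  (S2 : kalg k) (alpha1 alpha2 : kmor S S2) (HS2 : ring_tensor alpha alpha1 alpha2)
  (* A (x)_R S'' and B (x)_R S'' (S'' an R-algebra via alpha_1 o alpha = alpha_2 o alpha) *)
  (AS2 : ralg S2) (iAS2 : ahom (kcomp alpha alpha1) A AS2) (HAS2 : alg_bc iAS2)
  (BS2 : ralg S2) (iBS2 : ahom (kcomp alpha alpha1) B BS2) (HBS2 : alg_bc iBS2)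
  (* Id_A (x) alpha_i and Id_B (x) alpha_i : X (x)_R S -> X (x)_R S'' *)
  (eA1 eA2 : AS -> AS2) (eB1 eB2 : BS -> BS2)
  (HeA1 : slinear alpha1 eA1 /\ forall a, eA1 (iAS a) = iAS2 a)
  (HeA2 : slinear alpha2 eA2 /\ forall a, eA2 (iAS a) = iAS2 a)
  (HeB1 : slinear alpha1 eB1 /\ forall b, eB1 (iBS b) = iBS2 b)
  (HeB2 : slinear alpha2 eB2 /\ forall b, eB2 (iBS b) = iBS2 b)
  (* theta_1, theta_2 : the S''-linear maps corresponding to theta (x)_{alpha_i} Id_{S''} *)
  (theta1 theta2 : AS2 -> BS2)
  (Htheta1 : slinear (kid S2) theta1 /\ forall x, theta1 (eA1 x) = eB1 (theta x))
  (Htheta2 : slinear (kid S2) theta2 /\ forall x, theta2 (eA2 x) = eB2 (theta x))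
  (* the cocycle u = theta_2^-1 o theta_1 *)
  (u : ahom (kid S2) AS2 AS2) (Hu : forall x, theta2 (u x) = theta1 x)
  (F : kfunctor k) (HF : stable_bc F)
  (* F_R(A) (x)_R S, F_R(B) (x)_R S, F_R(A) (x)_R S'' *)
  (FAS : lmodType S) (jA : FO F A -> FAS) (HjA : mod_bc alpha jA)
  (FBS : lmodType S) (jB : FO F B -> FBS) (HjB : mod_bc alpha jB)
  (FAS2 : lmodType S2) (jA2 : FO F A -> FAS2) (HjA2 : mod_bc (kcomp alpha alpha1) jA2)
  (* nu_{A, alpha_i o alpha} (the same map for i = 1, 2) *)
  (nu : FAS2 -> FO F AS2)
  (Hnu : slinear (kid S2) nu /\ forall m, nu (jA2 m) = FM F iAS2 m)
  (* the cocycle z = nu^-1 o F(u) o nu *)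
  (z : FAS2 -> FAS2) (Hz : forall y, nu (z y) = FM F u (nu y))
  (* Id_{F_R(A)} (x) alpha_i : F_R(A) (x)_R S -> F_R(A) (x)_R S'' *)
  (d1 d2 : FAS -> FAS2)
  (Hd1 : slinear alpha1 d1 /\ forall m, d1 (jA m) = jA2 m)
  (Hd2 : slinear alpha2 d2 /\ forall m, d2 (jA m) = jA2 m) :
  (* F_R(B) is an S/R-form of F_R(A) *)
  (exists g : FAS -> FBS, slinear (kid S) g /\ bijective g) /\
  (* F_R(B) is R-isomorphic to L_z = {x | z((Id (x) alpha_1) x) = (Id (x) alpha_2) x} *)
  (exists f : FO F B -> FAS,
     [/\ slinear alpha f, injective f &
         forall x, z (d1 x) = d2 x <-> exists m, f m = x]).
Proof.
have hcomm : forall r, alpha1 (alpha r) = alpha2 (alpha r) := HS2.1.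
pose EA1 := alg_bc_ahom HAS HeA1.1 HeA1.2.
pose EA2 := alg_bc_ahom HAS HeA2.1 HeA2.2.
pose EB1 := alg_bc_ahom HBS HeB1.1 HeB1.2.
pose EB2 := alg_bc_ahom HBS HeB2.1 HeB2.2.
have Th1E a : theta1 (iAS2 a) = eB1 (theta (iAS a)) by rewrite -HeA1.2 Htheta1.2.
have Th2E a : theta2 (iAS2 a) = eB2 (theta (iAS a)) by rewrite -HeA2.2 Htheta2.2.
pose Th1 := alg_bc_ahom HAS2 (G := ahom_comp (ahom_comp iAS theta) EB1) Htheta1.1 Th1E.
pose Th2 := alg_bc_ahom HAS2 (G := ahom_comp (ahom_comp iAS theta) EB2) Htheta2.1 Th2E.
have [thetai [thetaK thetaiK]] := ahom_inv Htheta.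
have [Th2i Th2K] := alg_bc_iso_retraction (c := kcomp alpha alpha1) (b := alpha2) hcomm
  HAS2 HBS HBS2 (theta' := Th2) (eA := EA2) thetaK HeA2.2 HeB2.1 HeB2.2 Htheta2.2.
have [vA HvA vAb] := stable_bc_nu HF HAS HjA.
have [vB HvB vBb] := stable_bc_nu HF HBS HjB.
have [FBS2 [jB2 [e1B [e2B [HjB2 He1B He2B]]]]] := bc_descent_maps hcomm HjB.
have [vB2 HvB2 [vB2i vB2K _]] := stable_bc_nu HF HBS2 HjB2.
have [nui nuK _] := HF _ _ _ _ _ _ HAS2 _ _ HjA2 _ Hnu.1 Hnu.2.
have [Phi [hPhi [Phii PhiK PhiiK] PhiE]] :=
  FM_iso_transport thetaK thetaiK HvA.1 vAb HvB.1 vBb.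
split; first by exists Phi; split=> //; exists Phii.
have E1 x : vB2 (e1B (Phi x)) = FM F Th2 (nu (z (d1 x))).
  rewrite -(FM_nu_natural (iT' := iBS2) (E := EB1) (fun=> erefl) HeB1.2 HjB HvB HvB2 He1B).
  rewrite PhiE Hz (FM_comm (g := EB1) (f' := EA1) (g' := Th1) _ (fun y => esym (Htheta1.2 y))) //.
  rewrite (FM_nu_natural (iT' := iAS2) (E := EA1) (fun=> erefl) HeA1.2 HjA HvA Hnu Hd1).
  exact: (FM_comp (f := u) (g := Th2) (h := Th1) (fun=> erefl) (fun y => esym (Hu y))).
have E2 x : vB2 (e2B (Phi x)) = FM F Th2 (nu (d2 x)).
  rewrite -(FM_nu_natural (iT' := iBS2) (E := EB2) hcomm HeB2.2 HjB HvB HvB2 He2B).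
  rewrite PhiE (FM_comm (g := EB2) (f' := EA2) (g' := Th2) _ (fun y => esym (Htheta2.2 y))) //.
  by rewrite (FM_nu_natural (iT' := iAS2) (E := EA2) hcomm HeA2.2 HjA HvA Hnu Hd2).
exists (fun m => Phii (jB m)); split.
- exact: slinear_comp HjB.1 (slinear_can hPhi PhiK PhiiK) (fun=> erefl).
- by move=> m m' /(can_inj PhiiK) /(ff_bc_inj Hff HjB).
- move=> x; have -> : (z (d1 x) = d2 x) <-> (e1B (Phi x) = e2B (Phi x)).
    split=> [e|e]; first by apply: (can_inj vB2K); rewrite E1 E2 e.
    by apply: (can_inj nuK); apply: (can_inj (FM_can (F := F) Th2K)); rewrite -E1 -E2 e.
  rewrite (mod_bc_equalizer HS2 Hff HjB HjB2 He1B He2B).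
  by split=> -[m e]; exists m; rewrite -?e ?PhiK ?PhiiK // e PhiK.
Qed.
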